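(* Let $A \in \mathcal M_d(\mathbb R)$ satisfy $\rho(A) < 1$, let $\tau$ be a delay function such that $\inf_{s \in [0, t]} \tau(s) > 0$ for every $t \geq 0$ and $\lim_{t \to +\infty} (t - \tau(t)) = +\infty$, let $h$ be its associated largest delay function, and let $x\colon \lvert -h(0), +\infty) \to \mathbb R^d$ be a solution of $$x(t) = A x(t - \tau(t)), \qquad t \geq 0,$$ with bounded initial condition $x_0\colon \lvert -h(0), 0) \to \mathbb R^d$. Then $x(t) \to 0$ as $t \to +\infty$.
   Context: $\mathbb R_+ = [0, +\infty)$, $\mathbb R_+^\ast = (0, +\infty)$; $\mathcal M_d(\mathbb R)$ is the set of real $d \times d$ matrices, $d$ a positive integer, and $\rho(A)$ is the spectral radius of $A$. For $a \leq b$ in $\mathbb R \cup \{\pm\infty\}$, $\lvert a, b)$ denotes $[a, b)$ if $a > -\infty$ and $(a, b)$ if $a = -\infty$. A \emph{delay function} is any function $\tau\colon \mathbb R_+ \to \mathbb R_+^\ast$. Its \emph{largest delay function} is $h\colon \mathbb R_+ \to \mathbb R_+^\ast \cup \{+\infty\}$, $h(t) = t - \inf_{s \in [t, +\infty)} (s - \tau(s))$. A \emph{solution} is a function $x\colon \lvert -h(0), +\infty) \to \mathbb R^d$ such that $x(t) = A x(t - \tau(t))$ for every $t \in \mathbb R_+$; its \emph{initial condition} is its restriction to $\lvert -h(0), 0)$. *)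

(* Defs.v *)
From HB Require Import structures.
From mathcomp Require Import all_boot all_order all_algebra.
From mathcomp Require Import all_classical all_reals all_analysis.
From mathcomp Require Import complex.

Set Implicit Arguments.
Unset Strict Implicit.
Unset Printing Implicit Defensive.

Import Order.TTheory GRing.Theory Num.Theory.
Import numFieldNormedType.Exports.

Local Open Scope classical_set_scope.
Local Open Scope ring_scope.

(* Largest modulus of a complex eigenvalue of the real matrix A. *)
Definition spectral_radius (R : realType) (d : nat) (A : 'M[R]_d) : R :=
  sup [set ComplexField.Normc.normc z | z in
    [set z : R[i] | eigenvalue (map_mx (real_complex R) A) z]].

(* The set |a, b) of reals: since t%:E is finite, the left bound is excluded
   exactly when a = -oo. *)
Definition itv_bar (R : realType) (a b : \bar R) : set R :=
  [set t | (a <= t%:E < b)%E].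

(* Functions on R_+ are total functions on R whose values at negative
   arguments are never used. *)
Definition delay_function (R : realType) (tau : R -> R) : Prop :=
  forall t, 0 <= t -> 0 < tau t.

(* Extended-real valued: the infimum may be -oo, in which case the value
   is +oo. *)
Definition largest_delay (R : realType) (tau : R -> R) (t : R) : \bar R :=
  (t%:E - ereal_inf [set (s - tau s)%:E | s in `[t, +oo[])%E.

(* A function |-h(0), +oo) -> R^d is represented by a total function on R whose
   values outside |-h(0), +oo) are irrelevant: t - tau t lies in |-h(0), +oo)
   for every t >= 0. *)
Definition is_solution (R : realType) (d : nat) (A : 'M[R]_d) (tau : R -> R)
    (x : R -> 'cV[R]_d) : Prop :=
  forall t, 0 <= t -> x t = A *m x (t - tau t).

Definition bounded_initial_condition (R : realType) (d : nat) (tau : R -> R)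
    (x : R -> 'cV[R]_d) : Prop :=
  [bounded x t | t in itv_bar (- largest_delay tau 0)%E 0%E].

(* Main.v *)
(* Iterating the equation gives x t = A^n x s, where s is the time reached after n backward
   steps u |-> u - tau u. Since tau is bounded away from 0 on [0, t], the iteration reaches the
   initial interval after finitely many steps, so sup_n ||A^n|| times a bound on the initial
   condition bounds x on R_+. Since t - tau t tends to +oo, for fixed N the first N backward
   steps from a large t stay in R_+, so ||x t|| is at most ||A^N|| times that bound.
   That A^n tends to 0 is Cayley-Hamilton: removing the factors A - z of the split
   characteristic polynomial one at a time, u_n = A^n B satisfies
   u_(n+1) = z u_n + A^n (A - z) B with |z| < 1 and the last term tending to 0. *)
Require Import Defs.
From mathcomp Require Import all_boot all_order all_algebra.
From mathcomp Require Import all_classical all_reals all_analysis.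
From mathcomp Require Import complex.
From mathcomp Require Import lra.

Import Order.TTheory GRing.Theory Num.Theory.
Import numFieldNormedType.Exports.

Local Open Scope classical_set_scope.
Local Open Scope ring_scope.

Lemma cvg0_contraction {R : realType} {r : R} {a b : nat -> R} :
  0 <= r -> r < 1 -> (forall n, 0 <= a n) ->
  (forall n, a n.+1 <= r * a n + b n) ->
  b @ \oo --> 0 -> a @ \oo --> 0.
Proof.
move=> r0 r1 a0 a_step /cvgr0Pnorm_lt b_cvg.
apply/cvgr0Pnorm_lt => e e0.
(* Since [e / 2] is the fixed point of [y |-> r * y + (1 - r) * (e / 2)], once [b] stays below this
   threshold the excess of [a] over [e / 2] contracts by [r] at each step. *)
have e20 : 0 < (1 - r) * (e / 2) by apply: mulr_gt0; lra.
have [N _ bN] := b_cvg _ e20.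
have aN k : a (N + k)%N <= r ^+ k * a N + e / 2.
  elim: k => [|k IH]; first by rewrite addn0 expr0; lra.
  rewrite addnS exprS; apply: le_trans (a_step _) _.
  have := bN (N + k)%N (leq_addr _ _) => /= /ltW /ler_normlW.
  have := ler_wpM2l r0 IH; lra.
have rN : (fun k => a N * r ^+ k) @ \oo --> 0.
  by apply: cvg_geometric; rewrite ger0_norm.
have e2 : 0 < e / 2 by lra.
have /cvgr0Pnorm_lt /(_ _ e2) [K _ rK] := rN.
exists (N + K)%N => // n /= le_n.
have NKn : (N <= n)%N by exact: leq_trans (leq_addr _ _) le_n.
rewrite -(subnKC NKn) ger0_norm ?a0//; apply: le_lt_trans (aN _) _.
have := rK (n - N)%N; rewrite /= leq_subRL// => /(_ le_n) /(le_lt_trans (ler_norm _)).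
lra.
Qed.

Local Notation normc := ComplexField.Normc.normc.

Lemma cvg0_expr_mul {R : realType} {d : nat} {M : 'M[R[i]]_d.+1}
    {rs : seq R[i]} {B : 'M[R[i]]_d.+1} i j :
  (forall z, z \in rs -> normc z < 1) ->
  (\prod_(z <- rs) (M - z%:M)) * B = 0 ->
  normc ((M ^+ n * B) i j) @[n --> \oo] --> (0 : R).
Proof.
(* Roots are removed from the right: the last factor is the one next to [B], so the hypothesis,
   general in [B], applies to [(M - z%:M) * B]. *)
elim/last_ind: rs B => [|rs z IH] B rs1.
  rewrite big_nil mul1r => ->.
  under eq_fun do rewrite mulr0 mxE ComplexField.Normc.normc0.
  exact: cvg_cst.
rewrite big_rcons/= -mulrA => /IH cvgB.
apply: (@cvg0_contraction _ (normc z) _ (fun n => normc ((M ^+ n * ((M - z%:M) * B)) i j))).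
- by case: (z) => u v /=; exact: sqrtr_ge0.
- by apply: rs1; rewrite mem_rcons mem_head.
- by move=> n; case: (_ i j) => u v /=; exact: sqrtr_ge0.
- move=> n; rewrite -ComplexField.Normc.normcM.
  have -> : (M ^+ n.+1 * B) i j =
      z * (M ^+ n * B) i j + (M ^+ n * ((M - z%:M) * B)) i j.
    rewrite mulrBl mulrBr [z%:M * B]mul_scalar_mx -scalerAr mulrA -exprSr.
    by rewrite !mxE [RHS]addrC subrK.
  exact: le_normcD.
- by apply: cvgB => w w_rs; apply: rs1; rewrite mem_rcons inE w_rs orbT.
Qed.

Lemma normc_eigenvalue_le {R : realType} {d : nat} (A : 'M[R]_d) (z : R[i]) :
  eigenvalue (map_mx (real_complex R) A) z -> normc z <= spectral_radius A.
Proof.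
move=> ev_z; apply: ub_le_sup; last by exists z.
set p := char_poly (map_mx (real_complex R) A).
have [rs p_rs] := closed_field_poly_normal p.
(* A [sup] dominates its set only if the set is bounded above; eigenvalues are roots of [p], so the
   sum of the moduli of all roots is a bound. *)
exists (\sum_(w <- rs) normc w) => _ [w + <-].
rewrite /= eigenvalue_root_char -/p p_rs (monicP (char_poly_monic _)) scale1r.
rewrite root_prod_XsubC => w_rs.
rewrite (big_rem w)//= lerDl sumr_ge0// => -[u v] _ /=; exact: sqrtr_ge0.
Qed.

Lemma cvg0_expr_entry {R : realType} {d : nat} (A : 'M[R]_d.+1) i j :
  spectral_radius A < 1 -> `|(A ^+ n) i j| @[n --> \oo] --> (0 : R).
Proof.
move=> rhoA; pose M := map_mx (real_complex R) A.
have [rs] := closed_field_poly_normal (char_poly M).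
rewrite (monicP (char_poly_monic _)) scale1r => p_rs.
have rs1 z : z \in rs -> normc z < 1.
  rewrite -root_prod_XsubC -p_rs -eigenvalue_root_char => /normc_eigenvalue_le.
  by move/le_lt_trans; apply.
have : (\prod_(z <- rs) (M - z%:M)) * 1 = 0.
  rewrite mulr1 -[RHS](Cayley_Hamilton M) p_rs rmorph_prod/=.
  by apply: eq_bigr => z _; rewrite rmorphB/= horner_mx_X horner_mx_C.
move=> /(cvg0_expr_mul i j rs1).
apply: cvg_trans; apply: near_eq_cvg; apply: nearW => n.
(* Powers of [M] are the complex images of powers of [A], and on real numbers [normc] is the
   absolute value. *)
by rewrite mulr1 /M -rmorphXn mxE /= expr0n addr0 sqrtr_sqr.
Qed.

(** The norm of a matrix here is its largest absolute entry, which is not submultiplicative. The sum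
    of the entries dominates the corresponding operator norm and tends to 0 as soon as each entry
    does. *)
Definition entry_sum {R : realType} {m n : nat} (A : 'M[R]_(m, n)) : R :=
  \sum_i \sum_j `|A i j|.

Lemma entry_sum_ge0 {R : realType} {m n : nat} (A : 'M[R]_(m, n)) :
  0 <= entry_sum A.
Proof. by rewrite sumr_ge0// => i _; rewrite sumr_ge0. Qed.

Lemma entry_le_norm {R : realType} {m n : nat} (A : 'M[R]_(m, n)) i j :
  `|A i j| <= `|A|.
Proof.
rewrite [leRHS]mx_normrE.
exact: (le_bigmax _ (fun ij : 'I_m * 'I_n => `|A ij.1 ij.2|) (i, j)).
Qed.

Lemma norm_mulmx_le {R : realType} {m n : nat} (A : 'M[R]_(m, n))
    (v : 'cV[R]_n) : `|A *m v| <= entry_sum A * `|v|.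
Proof.
rewrite [leLHS]mx_normrE; apply/bigmax_leP; split => [|[i j] _ /=].
  by rewrite mulr_ge0// entry_sum_ge0.
rewrite mxE (le_trans (ler_norm_sum _ _ _))//.
apply: (@le_trans _ _ ((\sum_k `|A i k|) * `|v|)).
  rewrite mulr_suml; apply: ler_sum => k _.
  by rewrite normrM ler_wpM2l// entry_le_norm.
rewrite ler_wpM2r// /entry_sum (bigD1 i)//= lerDl sumr_ge0// => k _.
by rewrite sumr_ge0.
Qed.

Lemma cvg0_entry_sum_expr {R : realType} {d : nat} {A : 'M[R]_d.+1} :
  spectral_radius A < 1 -> entry_sum (A ^+ n) @[n --> \oo] --> (0 : R).
Proof.
move=> rhoA.
have -> : (0 : R) = \sum_(i < d.+1) \sum_(j < d.+1) 0.
  by rewrite big1// => i _; rewrite big1.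
by apply: cvg_big => // [|i _]; [exact: add_continuous|apply: cvg_big => // [|j _];
  [exact: add_continuous|exact: cvg0_expr_entry]].
Qed.

Section DelayIteration.
Context {R : realType} {tau : R -> R}.

(** [- largest_delay tau 0] is the infimum of [u - tau u] over [u >= 0], finite or not. *)
Lemma delayed_initial (s : R) : 0 <= s -> s - tau s < 0 ->
  itv_bar (- largest_delay tau 0)%E 0%E (s - tau s).
Proof.
move=> s0 s_lt0; rewrite /itv_bar/= lte_fin s_lt0 andbT /largest_delay.
rewrite sub0e oppeK; apply: ereal_inf_lbound; exists s => //=.
by rewrite in_itv/= s0.
Qed.

Lemma tau_ge_inf {t s : R} : delay_function tau -> 0 <= s <= t ->
  inf [set tau s | s in `[0, t]] <= tau s.
Proof.
move=> tau_gt0 s_itv; apply: ge_inf; last by exists s => //=; rewrite in_itv.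
by exists 0 => _ [u /= + <-]; rewrite in_itv/= => /andP[/tau_gt0/ltW].
Qed.

Lemma solution_initial_expr {d : nat} {A : 'M[R]_d.+1} {x : R -> 'cV[R]_d.+1} :
  delay_function tau ->
  (forall t : R, 0 <= t -> 0 < inf [set tau s | s in `[0, t]]) ->
  is_solution A tau x ->
  forall t, 0 <= t -> exists n, exists2 s,
    itv_bar (- largest_delay tau 0)%E 0%E s & x t = A ^+ n *m x s.
Proof.
move=> tau_gt0 tau_inf x_sol t t0.
set del := inf [set tau s | s in `[0, t]].
have del0 : 0 < del by exact: tau_inf.
(* Each backward step from a time in [[0, t]] goes back by at least [del], so from a time below
   [k%:R * del] at most [k] steps lead to a negative time. *)
suff main k s : 0 <= s <= t -> s < k%:R * del -> exists n, exists2 u,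
    itv_bar (- largest_delay tau 0)%E 0%E u & x s = A ^+ n *m x u.
  apply: (main (Num.bound (t / del))); first by rewrite t0 lexx.
  by rewrite -ltr_pdivrMr// archi_boundP// divr_ge0// ltW.
elim: k s => [|k IH] s /andP[s0 st]; first by rewrite mul0r ltNge s0.
move=> s_lt; rewrite (x_sol _ s0).
have tau_s := tau_ge_inf tau_gt0 (introT andP (conj s0 st)).
have [s'_lt0|s'_ge0] := ltP (s - tau s) 0.
  by exists 1%N, (s - tau s); [exact: delayed_initial|rewrite expr1].
have [||n [u u_init ->]] := IH (s - tau s).
- by rewrite s'_ge0/= (le_trans _ st)// gerBl ltW// tau_gt0.
- by move: s_lt tau_s; rewrite -/del -natr1 mulrDl mul1r; lra.
by exists n.+1, u; rewrite // mulmxA exprS.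
Qed.

Lemma solution_bounded {d : nat} {A : 'M[R]_d.+1} {x : R -> 'cV[R]_d.+1} :
  spectral_radius A < 1 -> delay_function tau ->
  (forall t : R, 0 <= t -> 0 < inf [set tau s | s in `[0, t]]) ->
  is_solution A tau x -> bounded_initial_condition tau x ->
  exists C, forall t, 0 <= t -> `|x t| <= C.
Proof.
move=> rhoA tau_gt0 tau_inf x_sol /pinfty_ex_gt0[M M0 xM].
(* The bound [K] is uniform in the exponent, as the number of backward steps depends on [t]. *)
have /cvgP/cvg_seq_bounded/pinfty_ex_gt0[K K0 AK] := cvg0_entry_sum_expr rhoA.
exists (K * M) => t /(solution_initial_expr tau_gt0 tau_inf x_sol)[n [s s_init ->]].
apply: le_trans (norm_mulmx_le _ _) _.
rewrite ler_pM ?entry_sum_ge0//; last exact: xM.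
by apply: le_trans (ler_norm _) _; exact: AK.
Qed.

Lemma near_solution_expr {d : nat} {A : 'M[R]_d.+1} {x : R -> 'cV[R]_d.+1} n :
  t - tau t @[t --> +oo] --> +oo -> is_solution A tau x ->
  \forall t \near +oo, exists2 s, 0 <= s & x t = A ^+ n *m x s.
Proof.
move=> tau_lim x_sol; elim: n => [|n IH].
  near=> t; exists t; last by rewrite expr0 mul1mx.
  by near: t; exact: nbhs_pinfty_ge.
(* What holds near [+oo] holds at [t - tau t] for all large [t]. *)
have IH' := tau_lim _ IH.
near=> t; have t0 : 0 <= t by near: t; exact: nbhs_pinfty_ge.
have [s s0 xs] : exists2 s, 0 <= s & x (t - tau t) = A ^+ n *m x s by near: t.
by exists s; rewrite // (x_sol _ t0) xs mulmxA exprS.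
Unshelve. all: by end_near. Qed.

End DelayIteration.

Theorem theorem5p1 (R : realType) (d : nat) (d_gt0 : (0 < d)%N)
    (A : 'M[R]_d) (rhoA : spectral_radius A < 1)
    (tau : R -> R) (tau_delay : delay_function tau)
    (tau_inf : forall t : R, 0 <= t -> 0 < inf [set tau s | s in `[0, t]])
    (tau_lim : t - tau t @[t --> +oo] --> +oo)
    (x : R -> 'cV[R]_d) (x_sol : is_solution A tau x)
    (x_init : bounded_initial_condition tau x) :
  x t @[t --> +oo] --> (0 : 'cV[R]_d).
Proof.
(* A successor dimension gives square matrices the ring structure behind [A ^+ n]. *)
case: d d_gt0 A rhoA x x_sol x_init => // d _ A rhoA x x_sol x_init.
have [C xC] := solution_bounded rhoA tau_delay tau_inf x_sol x_init.
apply/cvgr0Pnorm_lt => e e0.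
have C0 : 0 <= C by apply: le_trans (xC 0 _).
(* [C + 1] replaces [C], which may be 0. *)
have eC : 0 < e / (C + 1) by rewrite divr_gt0// ltr_wpDl.
have /cvgr0Pnorm_lt/(_ _ eC)[n _ /(_ n (leqnn n))/= An] := cvg0_entry_sum_expr rhoA.
near=> t.
have [s s0 ->] : exists2 s, 0 <= s & x t = A ^+ n *m x s.
  by near: t; exact: near_solution_expr n tau_lim x_sol.
apply: le_lt_trans (norm_mulmx_le _ _) _.
apply: (@le_lt_trans _ _ (entry_sum (A ^+ n) * (C + 1))).
  by rewrite ler_wpM2l ?entry_sum_ge0// (le_trans (xC _ s0))// lerDl.
rewrite -ltr_pdivlMr ?ltr_wpDl//; exact: le_lt_trans (ler_norm _) An.
Unshelve. all: by end_near. Qed.
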